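(* Let $N \geq 8$ be a nonsquare integer (i.e. an integer that is not a perfect square). Then $$s(N) \geq \frac{1}{2}+\sqrt{N-\lfloor\sqrt{N}\rfloor+\frac{1}{4}} > \sqrt{N}.$$
   Context: For a positive integer $N$, $s(N)$ denotes the smallest side length of a square containing $N$ unit squares (closed squares of side length $1$) with pairwise disjoint interiors, where the unit squares may be translated and rotated independently. *)

(* Defs.v *)
From HB Require Import structures.
From mathcomp Require Import all_boot all_order all_algebra.
From mathcomp Require Import all_classical all_reals all_analysis.

Set Implicit Arguments.
Unset Strict Implicit.
Unset Printing Implicit Defensive.

Import Order.TTheory GRing.Theory Num.Theory.
Import numFieldNormedType.Exports.

Local Open Scope classical_set_scope.
Local Open Scope ring_scope.

Definition rigid_motion (R : realType) (v : R * R) (t : R) (p : R * R) : R * R :=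
  (v.1 + cos t * p.1 - sin t * p.2, v.2 + sin t * p.1 + cos t * p.2).

(* Squares are invariant under a reflection, so translations and rotations
   produce every closed square of side length a. *)
Definition closed_square (R : realType) (a : R) (v : R * R) (t : R) :
    set (R * R) :=
  rigid_motion v t @` (`[0, a] `*` `[0, a]).

Definition packs (R : realType) (N : nat) (S : set (R * R)) : Prop :=
  exists (v : 'I_N -> R * R) (t : 'I_N -> R),
    (forall i, closed_square 1 (v i) (t i) `<=` S) /\
    trivIset setT (fun i => interior (closed_square 1 (v i) (t i))).

Definition packing_sides (R : realType) (N : nat) : set R :=
  [set a | 0 < a /\
           exists (w : R * R) (u : R), packs N (closed_square a w u)].

(* For N >= 1 the infimum is attained, by compactness, so it is the smallest
   side length. *)
Definition s (R : realType) (N : nat) : R := inf (@packing_sides R N).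

(* Main.v *)
(* Rotate so that the container is [0, a]^2, and let n be the integer part of a.
   Fix h slightly below 1 and put on the container the measure made of
   - area on the strip h <= y <= a - h,
   - length with density 1/2 on each of the lines y = h and y = a - h,
   - n point masses 1/2 at height h - 1/8 and n at height a - h + 1/8, at the
     multiples of some g < 1 with n g > a - 1.
   Its total mass a (a - 2 h) + a + n tends to a^2 - a + n as h tends to 1, and
   every unit square inside has mass at least 1: the part cut off by the line
   y = h has area at most half the sum of the chord on that line and of the
   point masses. Indeed, either this area is at most half the chord, or the chord
   1/8 below the line has length at least 1 and so contains one of the points.
   Hence N <= a^2 - a + n, and an elementary computation finishes the proof. *)
Require Import Defs.
From mathcomp Require Import all_boot all_order all_algebra.
From mathcomp Require Import all_classical all_reals all_analysis.
From mathcomp Require Import measurable_realfun ring lra.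

Set Implicit Arguments.
Unset Strict Implicit.
Unset Printing Implicit Defensive.

Import Order.TTheory GRing.Theory Num.Theory.
Import numFieldNormedType.Exports.
Local Open Scope classical_set_scope.
Local Open Scope ring_scope.

(** * Chords and cut-off areas of a unit square, as functions of the height *)

Section Profile.
Context {R : realType}.
Implicit Types c s t x y : R.

Definition ramp x := Num.max 0 x.

(* For an open unit square with edge directions (c, s) and (-s, c), c, s >= 0:
   length of the horizontal chord at height t above the lowest vertex, and area
   of the part below this chord. The first is a trapezoidal function of t. *)
Definition chord_len c s t : R :=
  if c * s == 0 then (0 < t < 1)%R%:R else
  (ramp t - ramp (t - s) - ramp (t - c) + ramp (t - (c + s))) / (c * s).

Definition area_below c s t : R :=
  if c * s == 0 then ramp t - ramp (t - 1) else
  (ramp t ^+ 2 - ramp (t - s) ^+ 2 - ramp (t - c) ^+ 2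
   + ramp (t - (c + s)) ^+ 2) / (2 * (c * s)).

Lemma ramp_ge0 x : 0 <= x -> ramp x = x.
Proof. by move=> x0; rewrite /ramp max_r. Qed.

Lemma ramp_le0 x : x <= 0 -> ramp x = 0.
Proof. by move=> x0; rewrite /ramp max_l. Qed.

Lemma rampN x : ramp (- x) = ramp x - x.
Proof.
have [x0|/ltW x0] := leP 0 x.
  by rewrite (ramp_ge0 x0) ramp_le0 ?oppr_le0// subrr.
by rewrite (ramp_le0 x0) ramp_ge0 ?oppr_ge0// sub0r.
Qed.

Lemma ramp_sqrN x : ramp (- x) ^+ 2 = x ^+ 2 - ramp x ^+ 2.
Proof.
have [x0|/ltW x0] := leP 0 x.
  by rewrite (ramp_ge0 x0) ramp_le0 ?oppr_le0// expr0n subrr.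
by rewrite (ramp_le0 x0) ramp_ge0 ?oppr_ge0// expr0n subr0 sqrrN.
Qed.

Lemma chord_lenC c s t : chord_len c s t = chord_len s c t.
Proof.
rewrite /chord_len (mulrC s c) (addrC s c); case: ifP => // _.
by congr (_ / _); ring.
Qed.

Lemma area_belowC c s t : area_below c s t = area_below s c t.
Proof.
rewrite /area_below (mulrC s c) (addrC s c); case: ifP => // _.
by congr (_ / _); ring.
Qed.

Lemma unit_axis c s : 0 <= c -> 0 <= s -> c ^+ 2 + s ^+ 2 = 1 ->
  c * s = 0 -> (c = 1 /\ s = 0) \/ (c = 0 /\ s = 1).
Proof.
move=> c0 s0 cs1 /eqP; rewrite mulf_eq0 => /orP[]/eqP e; [right|left].
  have : s ^+ 2 = 1 ^+ 2 by rewrite expr1n -cs1 e; ring.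
  by move=> /pexpIrn; rewrite !nnegrE => -> //.
have : c ^+ 2 = 1 ^+ 2 by rewrite expr1n -cs1 e; ring.
by move=> /pexpIrn; rewrite !nnegrE => -> //.
Qed.

Lemma unit_nonaxis c s : 0 <= c -> 0 <= s -> c * s != 0 -> 0 < c /\ 0 < s.
Proof.
rewrite mulf_eq0 negb_or => c0 s0 /andP[cn sn].
by rewrite !lt_def c0 s0 cn sn.
Qed.

(** The half turn about its centre preserves the square and exchanges the heights [t] and
    [c + s - t]. Together with [area_below_sym], this reduces the top of the container to the
    bottom. *)
Lemma chord_len_sym c s t : 0 <= c -> 0 <= s -> c ^+ 2 + s ^+ 2 = 1 ->
  chord_len c s (c + s - t) = chord_len c s t.
Proof.
move=> c0 s0 cs1; rewrite /chord_len; case: eqP => [e|_].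
  by have [[-> ->]|[-> ->]] := unit_axis c0 s0 cs1 e;
     congr (nat_of_bool _)%:R; apply/andP/andP => -[? ?]; split; lra.
rewrite (_ : c + s - t - s = - (t - c)); last by ring.
rewrite (_ : c + s - t - c = - (t - s)); last by ring.
rewrite (_ : c + s - t - (c + s) = - t); last by ring.
rewrite (_ : c + s - t = - (t - (c + s))); last by ring.
by rewrite !rampN; congr (_ / _); ring.
Qed.

Lemma area_below_sym c s t : 0 <= c -> 0 <= s -> c ^+ 2 + s ^+ 2 = 1 ->
  area_below c s (c + s - t) = 1 - area_below c s t.
Proof.
move=> c0 s0 cs1; rewrite /area_below; case: eqP => [e|/eqP n0].
  have -> : c + s = 1 by have [[-> ->]|[-> ->]] := unit_axis c0 s0 cs1 e; ring.
  rewrite (_ : 1 - t - 1 = - t); last by ring.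
  rewrite (_ : 1 - t = - (t - 1)); last by ring.
  by rewrite !rampN; ring.
have cs0 : 2 * (c * s) != 0 by rewrite mulf_neq0.
apply: (mulIf cs0); rewrite mulrBl !mulfVK// mul1r.
rewrite (_ : c + s - t - s = - (t - c)); last by ring.
rewrite (_ : c + s - t - c = - (t - s)); last by ring.
rewrite (_ : c + s - t - (c + s) = - t); last by ring.
rewrite (_ : c + s - t = - (t - (c + s))); last by ring.
by rewrite !ramp_sqrN; ring.
Qed.

Lemma chord_len_out c s t : 0 < c -> 0 < s -> t <= 0 \/ c + s <= t ->
  chord_len c s t = 0.
Proof.
move=> c0 s0 t0; have cs0 : 0 < c * s by rewrite mulr_gt0.
rewrite /chord_len gt_eqF// (_ : _ + _ = 0) ?mul0r//; case: t0 => t0.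
  by rewrite !ramp_le0; lra.
by rewrite !ramp_ge0; lra.
Qed.

Lemma chord_len_in c s t : 0 < c -> 0 < s -> 0 <= t -> t <= c + s ->
  chord_len c s t = (t - ramp (t - s) - ramp (t - c)) / (c * s).
Proof.
move=> c0 s0 t0 t1; have cs0 : 0 < c * s by rewrite mulr_gt0.
rewrite /chord_len gt_eqF// (ramp_ge0 t0) (@ramp_le0 (t - (c + s))) ?addr0//.
by rewrite subr_le0.
Qed.

(** A horizontal line meets the square in the intersection of two intervals, so the chord is at most
    each of the four differences between an upper and a lower end. Beyond the square one of these
    may be negative, whence the first alternative. *)
Lemma chord_len_bounds c s t : 0 < c -> 0 < s -> chord_len c s t = 0 \/
  [/\ chord_len c s t <= t / (c * s), chord_len c s t <= c^-1,
      chord_len c s t <= s^-1 & chord_len c s t <= (c + s - t) / (c * s)].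
Proof.
move=> c0 s0; have cs0 : 0 < c * s by rewrite mulr_gt0.
have [t0|/ltW t0] := leP t 0; first by left; rewrite chord_len_out//; left.
have [t1|/ltW t1] := leP (c + s) t; first by left; rewrite chord_len_out//; right.
right; rewrite chord_len_in//.
have -> : c^-1 = s / (c * s) by field; rewrite !gt_eqF.
have -> : s^-1 = c / (c * s) by field; rewrite !gt_eqF.
rewrite !ler_pM2r ?invr_gt0// /ramp.
by case: (leP 0 (t - s)) => ?; case: (leP 0 (t - c)) => ?; split; lra.
Qed.

(** The trapezoid rises as [t / (c * s)], which reaches 1 at [t = c * s], has a plateau at the
    smaller of [c^-1] and [s^-1], which is at least 1, and falls symmetrically. *)
Lemma chord_len_ge1 c s t : 0 < c -> 0 < s -> c <= 1 -> s <= 1 ->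
  c * s <= t -> c * s <= c + s - t -> 1 <= chord_len c s t.
Proof.
move=> c0 s0 c1 s1 t0 t1; have cs0 : 0 < c * s by rewrite mulr_gt0.
have csc : c * s <= c by rewrite ler_piMr// ltW.
have css : c * s <= s by rewrite ler_piMl// ltW.
rewrite chord_len_in//; [|lra|lra].
rewrite ler_pdivlMr// mul1r /ramp.
by case: (leP 0 (t - s)) => ?; case: (leP 0 (t - c)) => ?; lra.
Qed.

Lemma chord_len_ge0 c s t : 0 <= c -> 0 <= s -> 0 <= chord_len c s t.
Proof.
move=> c0 s0; have [e|n0] := eqVneq (c * s) 0.
  by rewrite /chord_len e eqxx ler0n.
have [{}c0 {}s0] := unit_nonaxis c0 s0 n0.
have [t0|/ltW t0] := leP t 0; first by rewrite chord_len_out//; left.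
have [t1|/ltW t1] := leP (c + s) t; first by rewrite chord_len_out//; right.
rewrite chord_len_in// divr_ge0 ?(mulr_ge0 (ltW c0) (ltW s0))// /ramp.
by case: (leP 0 (t - s)) => ?; case: (leP 0 (t - c)) => ?; lra.
Qed.

(** The local inequality at one line. It fails at [t = 1] for an axis-parallel square, whose area
    below is 1 while its chord there counts as empty; this is why [h] has to stay below 1. *)
Lemma area_below_le c s t : 0 <= c -> 0 <= s -> c ^+ 2 + s ^+ 2 = 1 ->
  t < 1 ->
  area_below c s t <=
    (chord_len c s t + (1 <= chord_len c s (t - 1 / 8))%R%:R) / 2.
Proof.
wlog sc : c s / s <= c.
  move=> H c0 s0 cs1 t1; case: (leP s c) => [|/ltW] sc; first exact: H.
  by rewrite area_belowC !(chord_lenC c) H// addrC.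
move=> c0 s0 cs1 t1.
case: (eqVneq (c * s) 0) => [e|n0].
  rewrite /area_below e eqxx (@ramp_le0 (t - 1)) ?subr0; last lra.
  case: (ltP 0 t) => t0; last first.
    by rewrite ramp_le0// divr_ge0// addr_ge0 ?ler0n// chord_len_ge0.
  rewrite (ramp_ge0 (ltW t0)) /chord_len e eqxx t1 t0 /=.
  case: (ltP 0 (t - 1 / 8)) => t0' /=; last first.
    by have := ler0n R (1 <= (0%:R : R))%R; lra.
  have -> : t - 1 / 8 < 1 by lra.
  by rewrite lexx /=; lra.
have [cp sp] := unit_nonaxis c0 s0 n0.
have c1 : c <= 1 by nra.
have s1 : s <= 1 by nra.
have u1 : 1 <= c + s by nra.
have Pp : 0 < c * s by rewrite mulr_gt0.
(* There are two ways to conclude: [half] does without the point mass, and [full] gets it from a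
   chord of length at least 1 at height [t - 1 / 8]. *)
have half : area_below c s t <= chord_len c s t / 2 ->
    area_below c s t <=
    (chord_len c s t + (1 <= chord_len c s (t - 1 / 8))%R%:R) / 2.
  by have := ler0n R (1 <= chord_len c s (t - 1 / 8))%R; lra.
have full : c * s <= t - 1 / 8 -> c * s <= c + s - (t - 1 / 8) ->
    2 * (c * s) * area_below c s t <= c * s * chord_len c s t + c * s ->
    area_below c s t <=
    (chord_len c s t + (1 <= chord_len c s (t - 1 / 8))%R%:R) / 2.
  move=> h1 h2 h3; rewrite chord_len_ge1//= ler_pdivlMr// -(ler_pM2l Pp); lra.
have half' : 2 * (c * s) * area_below c s t <= c * s * chord_len c s t ->
    area_below c s t <= chord_len c s t / 2.
  by move=> h; rewrite ler_pdivlMr// -(ler_pM2l Pp); lra.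
have AE : 2 * (c * s) * area_below c s t =
  (ramp t ^+ 2 - ramp (t - s) ^+ 2 - ramp (t - c) ^+ 2
   + ramp (t - (c + s)) ^+ 2).
  by rewrite /area_below (negbTE n0) mulrC mulfVK// mulf_neq0.
have LE : c * s * chord_len c s t =
  (ramp t - ramp (t - s) - ramp (t - c) + ramp (t - (c + s))).
  by rewrite /chord_len (negbTE n0) mulrC mulfVK.
rewrite AE LE in full half'.
rewrite (@ramp_le0 (t - (c + s))) in full half'; last lra.
case: (leP t 0) => t0.
  apply/half/half'; rewrite !ramp_le0; lra.
rewrite (@ramp_ge0 t) in full half'; last lra.
case: (leP t s) => ts.
  by apply/half/half'; rewrite !ramp_le0; nra.
rewrite (@ramp_ge0 (t - s)) in full half'; last lra.
case: (leP t c) => tc.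
  rewrite (@ramp_le0 (t - c)) in full half'; last lra.
  (* Between the two middle vertices the chord is [c^-1] and the area is [(2 * t - s) / (2 * c)], so
     half the chord suffices exactly up to [t = (1 + s) / 2]. *)
  case: (leP t ((1 + s) / 2)) => ts2.
    by apply/half/half'; nra.
  apply: full; [nra|nra|nra].
rewrite (@ramp_ge0 (t - c)) in full half'; last lra.
have c7 : 7 / 10 <= c by nra.
have s7 : s <= 5 / 7 by nra.
have u2 : c + s <= 3 / 2 by nra.
(* Put [w = c + s - 1]. Then [c * s = w + w ^+ 2 / 2] with [w <= 1 / 2], so [c * s] exceeds [w] by
   at most [1 / 8], which the offset of the point masses absorbs; moreover [w < c + s - t]. *)
have PE : c * s = (c + s - 1) ^+ 2 / 2 + (c + s - 1).
  by have -> : c * s = ((c + s) ^+ 2 - (c ^+ 2 + s ^+ 2)) / 2 by [field];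
     rewrite cs1; field.
have w2 : (c + s - 1) ^+ 2 <= (1 / 2) ^+ 2.
  by rewrite ler_sqr ?nnegrE; lra.
have r2 : (c + s - 1) ^+ 2 <= (c + s - t) ^+ 2.
  by rewrite ler_sqr ?nnegrE; lra.
apply: full; [|lra|].
  suff : 7 / 10 * (2 / 7) <= c * (1 - s) by lra.
  by apply: ler_pM; lra.
(* Above both middle vertices only a corner triangle of area [(c + s - t) ^+ 2 / (2 * (c * s))] is
   missing. *)
rewrite (_ : t ^+ 2 - _ - _ + _ = 2 * (c * s) - (c + s - t) ^+ 2); last by ring.
by have := sqr_ge0 (c + s - 1); lra.
Qed.

End Profile.

(** * Areas as integrals of chord lengths *)

Section Integral.
Context {R : realType}.
Implicit Types b c s t x y : R.

(** The quadratic error persists when [x] and [x + h] lie on opposite sides of 0, so the squared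
    ramp is differentiable at 0 as well. *)
Lemma ramp_sqr_taylor x h :
  `|ramp (x + h) ^+ 2 - ramp x ^+ 2 - h * (2 * ramp x)| <= h ^+ 2.
Proof.
have [x0|x0] := leP x 0; have [y0|y0] := leP (x + h) 0;
  rewrite ?(ramp_le0 x0) ?(ramp_le0 y0) ?(ramp_ge0 (ltW x0)) ?(ramp_ge0 (ltW y0))
    ler_norml; apply/andP; split; nra.
Qed.

Lemma is_derive_ramp_sqr x :
  is_derive x (1 : R) (fun y : R => ramp y ^+ 2) (2 * ramp x).
Proof.
have H : h^-1 *: (ramp (h *: (1 : R) + x) ^+ 2 - ramp x ^+ 2)
    @[h --> (0 : R)^'] --> 2 * ramp x.
  apply/cvgrPdist_le => e e0.
  near=> h.
  have h0 : h != 0 by near: h; exact: nbhs_dnbhs_neq.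
  have he : `|h| <= e by near: h; exact: dnbhs0_le.
  apply: le_trans he; have h1 : 0 < `|h| by rewrite normr_gt0.
  rewrite -(ler_pM2l h1) -normrM -expr2 real_normK ?num_real//.
  rewrite (_ : h * (_ - _) = h * (2 * ramp x) -
    (ramp (h *: 1 + x) ^+ 2 - ramp x ^+ 2)); last first.
    by rewrite mulrBr; congr (_ - _); exact: (mulVKf h0).
  rewrite distrC.
  rewrite (_ : h *: 1 + x = x + h); last by rewrite addrC scaler1.
  exact: ramp_sqr_taylor.
by apply: DeriveDef; [apply/cvg_ex; exists (2 * ramp x)|exact: cvg_lim].
Unshelve. all: by end_near. Qed.

Lemma continuous_ramp : continuous (@ramp R).
Proof. by move=> x; apply: continuous_max; [exact: cvg_cst|exact: cvg_id]. Qed.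

Lemma is_derive_ramp_sqr_shift k x :
  is_derive x (1 : R) (fun y : R => ramp (y - k) ^+ 2) (2 * ramp (x - k)).
Proof.
have := @is_derive1_comp R (fun y => ramp y ^+ 2) (fun y => y - k) x
  (2 * ramp (x - k)) 1 (is_derive_ramp_sqr _).
rewrite mulr1; apply.
exact: is_derive_shift.
Qed.

Lemma continuous_chord_len c s b : c * s != 0 ->
  continuous (fun y => chord_len c s (y - b)).
Proof.
move=> n0 x; rewrite /chord_len (negbTE n0).
have H0 : {for x, continuous (fun y => y - b)}.
  by apply: cvgB; [exact: cvg_id|exact: cvg_cst].
have Hk k : {for x, continuous (fun y => y - b - k)}.
  by apply: cvgB; [exact: H0|exact: cvg_cst].
have H k : {for x, continuous (fun y => ramp (y - b - k))}.
  by apply: (@continuous_comp _ _ _ (fun y => y - b - k)) => //; exact: continuous_ramp.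
apply: cvgM; last exact: cvg_cst.
apply: cvgD; last exact: H.
apply: cvgB; last exact: H.
apply: cvgB; last exact: H.
by apply: (@continuous_comp _ _ _ (fun y => y - b)) => //; exact: continuous_ramp.
Qed.

Lemma is_derive_area_below c s b x : c * s != 0 ->
  is_derive x (1 : R) (fun y => area_below c s (y - b)) (chord_len c s (x - b)).
Proof.
move=> n0; rewrite /area_below /chord_len (negbTE n0).
have E k y : y - b - k = y - (b + k) by ring.
under eq_fun do rewrite !E.
pose f k y : R := ramp (y - k) ^+ 2.
have D k : is_derive x (1 : R) (f k) (2 * ramp (x - k)).
  exact: is_derive_ramp_sqr_shift.
have H := is_deriveZ (2 * (c * s))^-1
  (is_deriveD (is_deriveB (is_deriveB (D b) (D (b + s))) (D (b + c)))
     (D (b + (c + s)))).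
rewrite (_ : (fun y => _) =
  (2 * (c * s))^-1 *: (f b - f (b + s) - f (b + c) + f (b + (c + s)))); last first.
  by apply/funext => y; rewrite mulrC.
apply: is_derive_eq H _; rewrite !E /GRing.scale/=; field.
by move: n0; rewrite mulf_eq0 negb_or => /andP[-> ->].
Qed.

Let mu := @lebesgue_measure R.

Lemma chord_len_axis c s b : c * s = 0 ->
  (fun y => chord_len c s (y - b)) = \1_`]b, b + 1[%classic.
Proof.
move=> e; apply/funext => y; rewrite /chord_len e eqxx indicE.
congr (nat_of_bool _)%:R; apply/idP/idP;
  by rewrite in_setE /= in_itv/= => /andP[? ?]; apply/andP; split; lra.
Qed.

Lemma measurable_chord_len c s b (D : set R) : 0 <= c -> 0 <= s ->
  measurable_fun D (fun y => chord_len c s (y - b)).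
Proof.
move=> c0 s0; apply: measurable_funTS.
have [e|n0] := eqVneq (c * s) 0; last first.
  by apply: continuous_measurable_fun; exact: continuous_chord_len.
rewrite chord_len_axis//; exact: measurable_indic.
Qed.

(** Off the axes this is the fundamental theorem of calculus. For an axis-parallel square the chord
    length jumps, but it is an indicator function, whose integral is the length of an overlap of
    intervals. *)
Lemma integral_chord_len c s b p q : 0 <= c -> 0 <= s -> c ^+ 2 + s ^+ 2 = 1 ->
  p < q ->
  ((area_below c s (q - b) - area_below c s (p - b))%:E <=
   \int[mu]_(y in `[p, q]) (chord_len c s (y - b))%:E)%E.
Proof.
move=> c0 s0 cs1 pq.
have [e|n0] := eqVneq (c * s) 0; last first.
  rewrite (@continuous_FTC2 _ _ (fun y => area_below c s (y - b)) _ _ pq)//.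
  - exact/continuous_subspaceT/continuous_chord_len.
  - have C x : {for x, continuous (fun y => area_below c s (y - b))}.
      apply/differentiable_continuous/derivable1_diffP.
      by have [] := is_derive_area_below b x n0.
    split.
    + by move=> x _; have [] := is_derive_area_below b x n0.
    + exact: cvg_at_right_filter (C p).
    + exact: cvg_at_left_filter (C q).
  - by move=> x _; rewrite derive1E; have [] := is_derive_area_below b x n0.
have -> : (\int[mu]_(y in `[p, q]) (chord_len c s (y - b))%:E =
    \int[mu]_(y in `[p, q]) (\1_`]b, b + 1[%classic y)%:E)%E.
  by apply: eq_integral => y _; rewrite -(chord_len_axis _ e).
rewrite integral_indic// /area_below e eqxx.
have [qb|bq] := leP q b.
  by rewrite !ramp_le0 ?subrr ?measure_ge0//; lra.
have [bp|pb] := leP (b + 1) p.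
  rewrite !ramp_ge0; [|lra..].
  by rewrite (_ : _ - _ = 0) ?measure_ge0//; ring.
(* What remains is a proper overlap; the open interval between these two ends lies in it and already
   has the required length. *)
have lohi : Num.max b p < Num.min (b + 1) q.
  by rewrite gt_max !lt_min; apply/andP; split; apply/andP; split; lra.
apply: (@le_trans _ _ (mu `](Num.max b p), (Num.min (b + 1) q)[%classic)).
  rewrite /mu lebesgue_measure_itv/= lte_fin lohi -EFinB lee_fin.
  rewrite (@ramp_ge0 _ (q - b)) ?(@ramp_le0 _ (p - b - 1)); [|lra..].
  have -> : ramp (q - b - 1) = q - Num.min (b + 1) q.
    by case: (leP (b + 1) q) => q1; [rewrite ramp_ge0|rewrite ramp_le0]; lra.
  have -> : ramp (p - b) = Num.max b p - b.
    by case: (leP b p) => p1; [rewrite ramp_ge0|rewrite ramp_le0]; lra.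
  lra.
apply: le_measure; rewrite ?inE//.
  by apply: measurableI.
move=> y/=; rewrite !in_itv/= gt_max lt_min => /andP[/andP[? ?] /andP[? ?]].
by split; apply/andP; split=> //; exact: ltW.
Qed.

End Integral.

(** * Bounds for the total chord length, point hits and area of disjoint squares *)

Section Counting.
Context {R : realType}.
Implicit Types (a b c l r x y : R) (v p : R * R).

(** The bounded quantities are the coordinates of [p] in the frame at the vertex [v] with axes
    [(c, s)] and [(- s, c)]. For [c, s >= 0] this vertex is a lowest one, so [p.2 - v.2] is the
    height used in [chord_len]. *)
Definition open_sq v c s : set (R * R) :=
  [set p | 0 < c * (p.1 - v.1) + s * (p.2 - v.2) < 1 /\
           0 < c * (p.2 - v.2) - s * (p.1 - v.1) < 1].

Lemma open_sq_chord v c s y : 0 <= c -> 0 <= s -> c ^+ 2 + s ^+ 2 = 1 ->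
  exists I : R * R, chord_len c s (y - v.2) <= Num.max 0 (I.2 - I.1) /\
    forall x, I.1 < x < I.2 -> open_sq v c s (x, y).
Proof.
move=> c0 s0 cs1; set t := y - v.2.
have empty : chord_len c s t <= 0 ->
    exists I : R * R, chord_len c s t <= Num.max 0 (I.2 - I.1) /\
    forall x, I.1 < x < I.2 -> open_sq v c s (x, y).
  move=> l0; exists (0, 0); rewrite subr0 maxxx; split=> // x /=.
  by move=> /andP[x0 x1]; have := lt_trans x0 x1; rewrite ltxx.
have [e|n0] := eqVneq (c * s) 0.
  have [t01|] := boolP (0 < t < 1); last first.
    by move=> /negbTE t01; apply: empty; rewrite /chord_len e eqxx t01.
  have le1 : chord_len c s t <= 1 by rewrite /chord_len e eqxx t01.
  clear empty; have [[ec es]|[ec es]] := unit_axis c0 s0 cs1 e;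
    rewrite ec es in le1 *.
    exists (v.1, v.1 + 1) => /=; split.
      by rewrite addrC addKr max_r.
    move=> x /andP[x0 x1]; rewrite /open_sq/= -/t; split; first by apply/andP; split; lra.
    by move/andP: t01 => [? ?]; apply/andP; split; lra.
  exists (v.1 - 1, v.1) => /=; split.
    by rewrite (_ : _ - _ = 1) ?max_r//; ring.
  move=> x /andP[x0 x1]; rewrite /open_sq/= -/t; split; last by apply/andP; split; lra.
  by move/andP: t01 => [? ?]; apply/andP; split; lra.
have [cp sp] := unit_nonaxis c0 s0 n0.
have [z|[b1 b2 b3 b4]] := chord_len_bounds t cp sp; first by apply: empty; rewrite z.
(* These ends solve the four linear inequalities of [open_sq] for [x]. Their four differences are
   the bounds of [chord_len_bounds], two of them by [c ^+ 2 + s ^+ 2 = 1]. *)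
exists (v.1 + Num.max (- (s * t) / c) ((c * t - 1) / s),
  v.1 + Num.min ((1 - s * t) / c) (c * t / s)) => /=; split.
  rewrite le_max; apply/orP; right.
  rewrite (_ : v.1 + _ - _ = Num.min ((1 - s * t) / c) (c * t / s) -
    Num.max (- (s * t) / c) ((c * t - 1) / s)); last by ring.
  have e1 : c^-1 = (1 - s * t) / c - - (s * t) / c by field; rewrite gt_eqF.
  have e2 : s^-1 = c * t / s - (c * t - 1) / s by field; rewrite gt_eqF.
  have e3 : t / (c * s) = c * t / s - - (s * t) / c.
    have -> : t / (c * s) = (c ^+ 2 + s ^+ 2) * t / (c * s) by rewrite cs1 mul1r.
    by field; rewrite !gt_eqF.
  have e4 : (c + s - t) / (c * s) = (1 - s * t) / c - (c * t - 1) / s.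
    have -> : (c + s - t) / (c * s) = (c + s - (c ^+ 2 + s ^+ 2) * t) / (c * s).
      by rewrite cs1 mul1r.
    by field; rewrite !gt_eqF.
  rewrite lerBrDl le_min -!lerBrDr !ge_max; apply/andP; split; apply/andP; split; lra.
move=> x; rewrite -ltrBrDl -[x < _ + _]ltrBlDl gt_max lt_min => /andP[/andP[]].
rewrite !ltr_pdivrMr// !ltr_pdivlMr// => h1 h2 /andP[h3 h4].
by rewrite /open_sq/= -/t; split; apply/andP; split; lra.
Qed.

Lemma itv_sub_bounds l r a : l < r -> (forall x, l < x < r -> 0 <= x <= a) ->
  0 <= l /\ r <= a.
Proof.
move=> lr H; split; rewrite leNgt; apply/negP => h.
  have [h1 h2] : l < Num.min 0 r /\ Num.min 0 r <= 0.
    by rewrite lt_min h lr ge_min lexx.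
  have h3 : Num.min 0 r <= r by rewrite ge_min lexx orbT.
  have : l < (l + Num.min 0 r) / 2 < r by apply/andP; split; lra.
  by move=> /H/andP[? _]; lra.
have [h1 h2] : Num.max a l < r /\ a <= Num.max a l.
  by rewrite gt_max h lr le_max lexx.
have h3 : l <= Num.max a l by rewrite le_max lexx orbT.
have : l < (Num.max a l + r) / 2 < r by apply/andP; split; lra.
by move=> /H/andP[_ ?]; lra.
Qed.

(** The first multiple of [g] beyond [l] is at distance at most [g < 1], hence before [r]. Its
    predecessor is at most [l <= a - 1 < n%:R * g], so it is among the first [n] positive
    multiples. *)
Lemma itv_hits n l r a g : 0 <= l -> r <= a -> 1 <= r - l ->
  0 < g -> g < 1 -> a - 1 < n%:R * g ->
  exists k : 'I_n, l < k.+1%:R * g < r.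
Proof.
move=> l0 ra rl g0 g1 ag.
have lg0 : 0 <= l / g by rewrite divr_ge0// ltW.
have /andP[k1 k2] := truncn_itv lg0.
rewrite ler_pdivlMr// in k1; rewrite ltr_pdivrMr// in k2.
have kn : (Num.truncn (l / g) < n)%N.
  rewrite -(ltr_nat R) -(ltr_pM2r g0); apply: le_lt_trans k1 _; lra.
exists (Ordinal kn) => /=; rewrite k2/= -natr1 mulrDl mul1r; lra.
Qed.

Context (N : nat) (a : R) (v : 'I_N -> R * R) (c s : 'I_N -> R).
Context (c0 : forall i, 0 <= c i) (s0 : forall i, 0 <= s i).
Context (cs1 : forall i, c i ^+ 2 + s i ^+ 2 = 1).
Context (inside : forall i p, open_sq (v i) (c i) (s i) p ->
  (0 <= p.1 <= a) /\ (0 <= p.2 <= a)).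
Context (disj : trivIset setT (fun i => open_sq (v i) (c i) (s i))).

Let len i y := chord_len (c i) (s i) (y - (v i).2).

(** One choice of intervals at height [y] serves both the length count and the point count; they are
    disjoint because the open squares are. *)
Lemma chords y : exists I : 'I_N -> R * R,
  [/\ forall i, len i y <= Num.max 0 ((I i).2 - (I i).1),
      forall i x, (I i).1 < x < (I i).2 -> open_sq (v i) (c i) (s i) (x, y) &
      forall i j x, (I i).1 < x < (I i).2 -> (I j).1 < x < (I j).2 -> i = j].
Proof.
have [I HI] := choice (fun i => open_sq_chord (v i) y (c0 i) (s0 i) (cs1 i)).
exists I; split=> [i|i|i j x xi xj]; try by case: (HI i).
apply: disj => //; exists (x, y); split.
- by case: (HI i) => _; exact.
- by case: (HI j) => _; exact.
Qed.

Let mu := @lebesgue_measure R.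

(** Disjoint intervals inside [[0, a]] have total length at most [a]. *)
Lemma sum_chord_len y : 0 <= a -> \sum_(i < N) len i y <= a.
Proof.
move=> a0; have [I [I1 I2 I3]] := chords y.
pose F i : set R := `](I i).1, (I i).2[%classic.
apply: (@le_trans _ _ (\sum_(i < N) Num.max 0 ((I i).2 - (I i).1))).
  exact: ler_sum.
rewrite -lee_fin -sumEFin.
rewrite (eq_bigr (fun i => mu (F i))); last first.
  move=> i _; rewrite /mu lebesgue_measure_itv/= lte_fin -EFinB.
  by case: ltP => h; [rewrite max_r ?subr_ge0 1?ltW|rewrite max_l// subr_le0].
have mU : measurable (\big[setU/set0]_(i < N) F i).
  by apply: bigsetU_measurable => i _; exact: measurable_itv.
rewrite -measure_semi_additive_ord//; last 2 first.
- by move=> i; exact: measurable_itv.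
- move=> i j _ _ [x []]; rewrite /F /= !in_itv/=; exact: I3.
have ma : mu `[0, a]%classic = a%:E.
  rewrite /mu lebesgue_measure_itv/= lte_fin.
  by case: ltP => h; [rewrite -EFinB subr0|congr EFin; apply/le_anti/andP].
rewrite -ma; apply: le_measure; rewrite ?inE//.
apply: (big_ind (fun A : set R => A `<=` `[0, a])) => // [A B AS BS x [/AS|/BS]//|i _ x].
by rewrite /F /= !in_itv/= => /I2/inside[].
Qed.

(** Pigeonhole: each chord of length at least 1 contains one of [n] fixed points, and disjoint
    chords contain different points. *)
Lemma sum_hits n y : 0 <= a -> a < n%:R + 1 ->
  \sum_(i < N) (1 <= len i y)%R%:R <= n%:R :> R.
Proof.
move=> a0 an; have [I [I1 I2 I3]] := chords y.
have wide i : 1 <= len i y ->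
    [/\ 0 <= (I i).1, (I i).2 <= a & 1 <= (I i).2 - (I i).1].
  move=> h; have h1 : 1 <= (I i).2 - (I i).1.
    by have := le_trans h (I1 i); rewrite le_max lt_geF ?ltr01.
  have [] := @itv_sub_bounds (I i).1 (I i).2 a; [lra| |by []].
  by move=> x /I2/inside[].
have [/existsP[i1 i1P]|/existsPn none] := boolP [exists i, 1 <= len i y]; last first.
  by rewrite big1// => i _; rewrite (negbTE (none i)).
have [h1 h2 h3] := wide _ i1P.
have a1 : 1 <= a by lra.
have np : 0 < n%:R :> R by lra.
have n0 : (0 < n)%N by rewrite -(ltr_nat R).
have [g [g0 g1 ag]] : exists g : R, [/\ 0 < g, g < 1 & a - 1 < n%:R * g].
  (* The midpoint of [(a - 1) / n%:R] and 1, which are in this order because [a < n%:R + 1]. *)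
  exists ((a - 1 + n%:R) / (2 * n%:R)); split.
  - by rewrite divr_gt0//; lra.
  - by rewrite ltr_pdivrMr; lra.
  - rewrite (_ : n%:R * _ = (a - 1 + n%:R) / 2); first lra.
    by field; rewrite gt_eqF.
have hit i : exists k : 'I_n, 1 <= len i y -> (I i).1 < k.+1%:R * g < (I i).2.
  (* A square with a short chord gets an arbitrary index; injectivity is only claimed on the long
     chords. *)
  have [/wide[l0 ra rl]|_] := boolP (1 <= len i y); last by exists (Ordinal n0).
  by have [k kP] := itv_hits l0 ra rl g0 g1 ag; exists k.
have [f Hf] := choice hit.
rewrite -natr_sum ler_nat -big_mkcond/= sum1_card -[X in (_ <= X)%N]card_ord.
rewrite -(@card_in_imset _ _ f) ?max_card// => i j iP jP fij.
by apply: I3 (Hf i iP) _; rewrite fij; exact: Hf.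
Qed.

(** Integrate the bound of [sum_chord_len] over the heights from [p] to [q]. *)
Lemma sum_area_between (p q : R) : 0 <= a -> p < q ->
  \sum_(i < N) (area_below (c i) (s i) (q - (v i).2) -
                area_below (c i) (s i) (p - (v i).2)) <= a * (q - p).
Proof.
move=> a0 pq; rewrite -lee_fin -sumEFin.
apply: (@le_trans _ _ (\sum_(i < N) \int[mu]_(y in `[p, q]) (len i y)%:E)%E).
  by apply: lee_sum => i _; exact: integral_chord_len.
rewrite -ge0_integral_sum//; last 2 first.
- by move=> i; apply/measurable_EFinP; exact: measurable_chord_len.
- by move=> i y _; rewrite lee_fin chord_len_ge0.
have <- : (\int[mu]_(y in `[p, q]) (cst a%:E y) = (a * (q - p))%:E)%E.
  rewrite integral_cst//= /mu lebesgue_measure_itv/= lte_fin pq -EFinB.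
  by rewrite EFinM.
apply: ge0_le_integral => //.
- by move=> y _; apply: sume_ge0 => i _; rewrite lee_fin chord_len_ge0.
- apply: emeasurable_sum => i; apply/measurable_EFinP; exact: measurable_chord_len.
- by move=> y _; rewrite sumEFin lee_fin sum_chord_len.
Qed.

End Counting.

(** * Comparison of masses in an axis-parallel container *)

Section Geometry.
Context {R : realType}.
Implicit Types (a b c l r x y : R) (v p : R * R).

Definition closed_sq a v c s : set (R * R) :=
  [set p | 0 <= c * (p.1 - v.1) + s * (p.2 - v.2) <= a /\
           0 <= c * (p.2 - v.2) - s * (p.1 - v.1) <= a].

Lemma card_le_area N a n (v : 'I_N -> R * R) (c s : 'I_N -> R) :
  2 <= a -> a < n%:R + 1 ->
  (forall i, [/\ 0 <= c i, 0 <= s i & c i ^+ 2 + s i ^+ 2 = 1]) ->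
  (forall i, closed_sq 1 (v i) (c i) (s i) `<=` `[0, a] `*` `[0, a]) ->
  trivIset setT (fun i => open_sq (v i) (c i) (s i)) ->
  N%:R <= a ^+ 2 - a + n%:R.
Proof.
move=> a2 an cs inside disj.
have a0 : 0 <= a by lra.
have oc i p : open_sq (v i) (c i) (s i) p -> closed_sq 1 (v i) (c i) (s i) p.
  by move=> [/andP[? ?] /andP[? ?]]; split; apply/andP; split; exact: ltW.
have inside' i p : open_sq (v i) (c i) (s i) p -> (0 <= p.1 <= a) /\ (0 <= p.2 <= a).
  by move=> /oc/inside[]/=; rewrite !in_itv.
have bot i : 0 <= (v i).2.
  have [? ? e] := cs i.
  have /inside[_ /=] : closed_sq 1 (v i) (c i) (s i) (v i).
    by rewrite /closed_sq/= !subrr !mulr0 addr0 subr0 lexx ler01.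
  by rewrite in_itv/= => /andP[].
have top i : (v i).2 + (c i + s i) <= a.
  have [? ? e] := cs i.
  have /inside[_ /=] : closed_sq 1 (v i) (c i) (s i)
      ((v i).1 + c i - s i, (v i).2 + (c i + s i)).
    rewrite /closed_sq/=.
    have -> : c i * ((v i).1 + c i - s i - (v i).1) +
      s i * ((v i).2 + (c i + s i) - (v i).2) = 1 by rewrite -e; ring.
    have -> : c i * ((v i).2 + (c i + s i) - (v i).2) -
      s i * ((v i).1 + c i - s i - (v i).1) = 1 by rewrite -e; ring.
    by rewrite ler01 lexx.
  by rewrite in_itv/= => /andP[].
have c0 i : 0 <= c i by have [] := cs i.
have s0 i : 0 <= s i by have [] := cs i.
have cs1 i : c i ^+ 2 + s i ^+ 2 = 1 by have [] := cs i.
pose len i y := chord_len (c i) (s i) (y - (v i).2).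
pose hit i y : R := (1 <= len i y)%R%:R.
pose below i y := area_below (c i) (s i) (y - (v i).2).
apply/ler_addgt0Pr => e e0.
(* With this [h] the total mass [a * (a - 2 * h) + a + n%:R] is exactly [a ^+ 2 - a + n%:R + e]. *)
pose h := 1 - e / (2 * a).
have h1 : h < 1 by rewrite gtrBl divr_gt0//; lra.
have ah : a * h = a - e / 2 by rewrite /h; field; rewrite gt_eqF//; lra.
(* The area between the lines is 1 minus the parts cut off below and above; [B] and [T] charge these
   parts to the lines and their points. *)
have mass i : 1 <= (below i (a - h) - below i h) +
    ((len i h + hit i (h - 1 / 8)) / 2 +
     (len i (a - h) + hit i (a - h + 1 / 8)) / 2).
  have bi := bot i; have ti := top i.
  have B : below i h <= (len i h + hit i (h - 1 / 8)) / 2.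
    have -> : hit i (h - 1 / 8) =
        (1 <= chord_len (c i) (s i) (h - (v i).2 - 1 / 8))%R%:R.
      by rewrite /hit /len; congr (nat_of_bool (_ <= chord_len _ _ _))%:R; ring.
    by apply: area_below_le => //; lra.
  have T : 1 - below i (a - h) <=
      (len i (a - h) + hit i (a - h + 1 / 8)) / 2.
    rewrite /hit /len /below -area_below_sym// -(chord_len_sym (a - h - _))//.
    rewrite -(chord_len_sym (a - h + 1 / 8 - (v i).2))//.
    rewrite (_ : c i + s i - (a - h + 1 / 8 - (v i).2) =
      c i + s i - (a - h - (v i).2) - 1 / 8); last by ring.
    by apply: area_below_le => //; lra.
  lra.
have := @ler_sum _ _ (index_enum 'I_N) xpredT _ _ (fun i _ => mass i).
rewrite sumr_const card_ord !big_split/= -!mulr_suml !big_split/=.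
have A := @sum_area_between R N a v c s c0 s0 cs1 inside' disj h (a - h) a0.
have C1 := @sum_chord_len R N a v c s c0 s0 cs1 inside' disj h a0.
have C2 := @sum_chord_len R N a v c s c0 s0 cs1 inside' disj (a - h) a0.
have H1 := @sum_hits R N a v c s c0 s0 cs1 inside' disj n (h - 1 / 8) a0 an.
have H2 := @sum_hits R N a v c s c0 s0 cs1 inside' disj n (a - h + 1 / 8) a0 an.
have {}A : \sum_(i < N) below i (a - h) - \sum_(i < N) below i h <= a * (a - h - h).
  (* The strip is nondegenerate, since [h < 1] and [2 <= a]. *)
  by rewrite -sumrB; apply: A; lra.
rewrite sumrN.
rewrite (_ : a * (a - h - h) = a ^+ 2 - 2 * (a * h)) in A; last by ring.
lra.
Qed.

End Geometry.

(** * From rigid motions to frames in the first quadrant *)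

Section Packing.
Context {R : realType}.
Implicit Types (a b c l r x y : R) (v p : R * R).

Lemma rigid_motion_inj w u : injective (@rigid_motion R w u).
Proof.
move=> p q []; have cs1 := cos2Dsin2 u => e1 e2.
rewrite [p]surjective_pairing [q]surjective_pairing; congr pair.
  have : (cos u ^+ 2 + sin u ^+ 2) * (p.1 - q.1) = 0; last by rewrite cs1; lra.
  transitivity (
    cos u * ((w.1 + cos u * p.1 - sin u * p.2)
             - (w.1 + cos u * q.1 - sin u * q.2))
    + sin u * ((w.2 + sin u * p.1 + cos u * p.2)
               - (w.2 + sin u * q.1 + cos u * q.2))); first ring.
  by rewrite e1 e2; ring.
have : (cos u ^+ 2 + sin u ^+ 2) * (p.2 - q.2) = 0; last by rewrite cs1; lra.
transitivity (
  cos u * ((w.2 + sin u * p.1 + cos u * p.2)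
           - (w.2 + sin u * q.1 + cos u * q.2))
  - sin u * ((w.1 + cos u * p.1 - sin u * p.2)
             - (w.1 + cos u * q.1 - sin u * q.2))); first ring.
by rewrite e1 e2; ring.
Qed.

Lemma closed_squareE a v t :
  closed_square a v t = closed_sq a v (cos t) (sin t).
Proof.
have cs1 := cos2Dsin2 t; apply/seteqP; split=> [_ [[x y] [/= xa ya] <-]|p [/= pa qa]].
  rewrite /= !in_itv/= in xa ya; rewrite /closed_sq/rigid_motion/=.
  have -> : cos t * (v.1 + cos t * x - sin t * y - v.1) +
    sin t * (v.2 + sin t * x + cos t * y - v.2) = x.
    by rewrite -[RHS]mul1r -cs1; ring.
  have -> : cos t * (v.2 + sin t * x + cos t * y - v.2) -
    sin t * (v.1 + cos t * x - sin t * y - v.1) = y.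
    by rewrite -[RHS]mul1r -cs1; ring.
  by [].
exists (cos t * (p.1 - v.1) + sin t * (p.2 - v.2),
        cos t * (p.2 - v.2) - sin t * (p.1 - v.1)).
  by rewrite /= !in_itv.
rewrite /rigid_motion/= [RHS]surjective_pairing; congr pair.
  transitivity (v.1 + (cos t ^+ 2 + sin t ^+ 2) * (p.1 - v.1)); first ring.
  by rewrite cs1; ring.
transitivity (v.2 + (cos t ^+ 2 + sin t ^+ 2) * (p.2 - v.2)); first ring.
by rewrite cs1; ring.
Qed.

Lemma open_sq_interior v t :
  open_sq v (cos t) (sin t) `<=` interior (closed_square 1 v t).
Proof.
pose f p := cos t * (p.1 - v.1) + sin t * (p.2 - v.2).
pose g p := cos t * (p.2 - v.2) - sin t * (p.1 - v.1).
have c1 (x : R * R) : p.1 - v.1 @[p --> x] --> x.1 - v.1.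
  by apply: cvgB; [exact: cvg_fst|exact: cvg_cst].
have c2 (x : R * R) : p.2 - v.2 @[p --> x] --> x.2 - v.2.
  by apply: cvgB; [exact: cvg_snd|exact: cvg_cst].
have cf : continuous f.
  by move=> x; apply: cvgD; apply: cvgM (cvg_cst _) _; [exact: c1|exact: c2].
have cg : continuous g.
  by move=> x; apply: cvgB; apply: cvgM (cvg_cst _) _; [exact: c2|exact: c1].
have oO : open (open_sq v (cos t) (sin t)).
  have -> : open_sq v (cos t) (sin t) = f @^-1` `]0, 1[ `&` g @^-1` `]0, 1[.
    by apply/seteqP; split=> p; rewrite /= !in_itv.
  by apply: openI; apply: open_comp => [x _|];
    by [exact: cf|exact: cg|exact: interval_open].
move=> p Op; rewrite closed_squareE.
apply: (@filterS _ (nbhs p) _ (open_sq v (cos t) (sin t))).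
  by move=> q [/andP[? ?] /andP[? ?]]; split; apply/andP; split; exact: ltW.
exact: open_nbhs_nbhs.
Qed.

(** The same square described from the vertex [v + (- s, c)], with the frame turned clockwise by a
    right angle. *)
Lemma quarter_turn v c s : c ^+ 2 + s ^+ 2 = 1 ->
  open_sq v c s = open_sq (v.1 - s, v.2 + c) s (- c) /\
  closed_sq 1 v c s = closed_sq 1 (v.1 - s, v.2 + c) s (- c).
Proof.
move=> cs1.
have X p : s * (p.1 - (v.1 - s)) + - c * (p.2 - (v.2 + c)) =
    1 - (c * (p.2 - v.2) - s * (p.1 - v.1)).
  by rewrite -cs1; ring.
have Y p : s * (p.2 - (v.2 + c)) - - c * (p.1 - (v.1 - s)) =
    c * (p.1 - v.1) + s * (p.2 - v.2) by ring.
split; apply/seteqP; split=> p; rewrite /open_sq /closed_sq/= X Y;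
  by move=> [/andP[? ?] /andP[? ?]]; split; apply/andP; split; lra.
Qed.

(** At most three quarter turns make both components nonnegative; the signs of [c] and [s] tell how
    many. *)
Lemma first_quadrant v c s : c ^+ 2 + s ^+ 2 = 1 ->
  exists w : (R * R) * (R * R),
    [/\ [/\ 0 <= w.2.1, 0 <= w.2.2 & w.2.1 ^+ 2 + w.2.2 ^+ 2 = 1],
    open_sq w.1 w.2.1 w.2.2 = open_sq v c s &
    closed_sq 1 w.1 w.2.1 w.2.2 = closed_sq 1 v c s].
Proof.
move=> cs1; have [E1 F1] := quarter_turn v cs1.
have cs2 : s ^+ 2 + (- c) ^+ 2 = 1 by rewrite -cs1; ring.
have [E2 F2] := quarter_turn (v.1 - s, v.2 + c) cs2.
have cs3 : (- c) ^+ 2 + (- s) ^+ 2 = 1 by rewrite -cs1; ring.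
have [E3 F3] :=
  quarter_turn ((v.1 - s, v.2 + c).1 - - c, (v.1 - s, v.2 + c).2 + s) cs3.
have [c0|/ltW c0] := leP 0 c; have [s0|/ltW s0] := leP 0 s.
- by exists (v, (c, s)).
- eexists (_, (- s, - - c)); rewrite /= E1 E2 E3 F1 F2 F3; split=> //.
  by split; [lra|lra|rewrite -cs1; ring].
- by eexists (_, (s, - c)); rewrite /= E1 F1; split=> //; split=> //; lra.
- by eexists (_, (- c, - s)); rewrite /= E1 E2 F1 F2; split=> //; split=> //; lra.
Qed.

(** Pulling a square back by the motion of the container turns its frame by [- u]; the new
    components are those of the difference formulas for cosine and sine. *)
Lemma rigid_motion_sq w u v c s : exists (v' : R * R) (c' s' : R),
  [/\ c' ^+ 2 + s' ^+ 2 = c ^+ 2 + s ^+ 2,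
    forall p, open_sq v' c' s' p = open_sq v c s (rigid_motion w u p) &
    forall p, closed_sq 1 v' c' s' p = closed_sq 1 v c s (rigid_motion w u p)].
Proof.
have u1 := cos2Dsin2 u.
pose v' := (cos u * (v.1 - w.1) + sin u * (v.2 - w.2),
            cos u * (v.2 - w.2) - sin u * (v.1 - w.1)).
exists v', (c * cos u + s * sin u), (s * cos u - c * sin u).
have X p : (c * cos u + s * sin u) * (p.1 - v'.1) +
    (s * cos u - c * sin u) * (p.2 - v'.2) =
    c * ((rigid_motion w u p).1 - v.1) + s * ((rigid_motion w u p).2 - v.2).
  rewrite /rigid_motion/=.
  transitivity (c * (cos u * p.1 - sin u * p.2) + s * (sin u * p.1 + cos u * p.2) +
    (cos u ^+ 2 + sin u ^+ 2) * (c * (w.1 - v.1) + s * (w.2 - v.2))); first ring.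
  by rewrite u1; ring.
have Y p : (c * cos u + s * sin u) * (p.2 - v'.2) -
    (s * cos u - c * sin u) * (p.1 - v'.1) =
    c * ((rigid_motion w u p).2 - v.2) - s * ((rigid_motion w u p).1 - v.1).
  rewrite /rigid_motion/=.
  transitivity (c * (sin u * p.1 + cos u * p.2) - s * (cos u * p.1 - sin u * p.2) +
    (cos u ^+ 2 + sin u ^+ 2) * (c * (w.2 - v.2) - s * (w.1 - v.1))); first ring.
  by rewrite u1; ring.
split=> [|p|p].
- transitivity ((c ^+ 2 + s ^+ 2) * (cos u ^+ 2 + sin u ^+ 2)); first ring.
  by rewrite u1 mulr1.
- by rewrite /open_sq/= X Y.
- by rewrite /closed_sq/= X Y.
Qed.

(** Allowing a larger side [b] extends the mass bound, which requires side at least 2, to small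
    containers. *)
Lemma packs_le N n a b w u : packs N (closed_square a w u) ->
  a <= b -> 2 <= b -> b < n%:R + 1 -> N%:R <= b ^+ 2 - b + n%:R.
Proof.
move=> [v [t [sub disj]]] ab b2 bn.
have H i : exists q : (R * R) * (R * R),
    [/\ [/\ 0 <= q.2.1, 0 <= q.2.2 & q.2.1 ^+ 2 + q.2.2 ^+ 2 = 1],
      forall p, open_sq q.1 q.2.1 q.2.2 p ->
        interior (closed_square 1 (v i) (t i)) (rigid_motion w u p) &
      closed_sq 1 q.1 q.2.1 q.2.2 `<=` `[0, b] `*` `[0, b]].
  have [v' [c' [s' [cs1 O C]]]] := rigid_motion_sq w u (v i) (cos (t i)) (sin (t i)).
  rewrite cos2Dsin2 in cs1.
  have [q [q1 qO qC]] := first_quadrant v' cs1.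
  exists q; split=> // [p|p]; first by rewrite qO O => /open_sq_interior.
  rewrite qC C -closed_squareE => /sub [[x y] [/= xa ya]].
  move=> /rigid_motion_inj <-.
  by rewrite !in_itv/= in xa ya *; split; lra.
have [q Hq] := choice H.
apply: (@card_le_area R N b n (fun i => (q i).1) (fun i => (q i).2.1)
  (fun i => (q i).2.2)) => // [i|i|i j _ _ [p [pi pj]]]; try by have [] := Hq i.
apply: disj => //; exists (rigid_motion w u p); split.
  by have [_ + _] := Hq i; apply.
by have [_ + _] := Hq j; apply.
Qed.

End Packing.

(** * From the mass bound to the infimum *)

Lemma packing_sides_neq0 (R : realType) N : (0 < N)%N ->
  @packing_sides R N !=set0.
Proof.
move=> N0; exists (2 * N%:R); split; first by rewrite mulr_gt0// ltr0n.
(* A row of unit squares at abscissas [2 * i], with unit gaps, inside a square of side [2 * N]. *)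
exists (0, 0), 0, (fun i => (2 * i%:R, 0)), (fun=> 0).
have E (i : nat) (p : R * R) : closed_square 1 (2 * i%:R, 0) 0 p <->
    (2 * i%:R <= p.1 <= 2 * i%:R + 1) /\ (0 <= p.2 <= 1).
  rewrite closed_squareE cos0 sin0 /closed_sq/= !mul1r !mul0r addr0 !subr0.
  by rewrite subr_ge0 lerBlDl.
split=> [i p /E[/andP[p1 p2] /andP[p3 p4]]|].
  rewrite closed_squareE cos0 sin0 /closed_sq/= !mul1r !mul0r addr0 !subr0.
  have iN : i%:R + 1 <= N%:R :> R by rewrite natr1 ler_nat.
  have i0 : 0 <= i%:R :> R by [].
  by split; apply/andP; split; lra.
move=> i j _ _ [p [/interior_subset/E[/andP[p1 p2] _]]].
move=> /interior_subset/E[/andP[p3 p4] _].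
have ij (k l : nat) : 2 * k%:R <= p.1 -> p.1 <= 2 * l%:R + 1 -> (k <= l)%N.
  move=> h1 h2; rewrite -ltnS -(ltr_nat R) -natr1; lra.
by apply/val_inj/eqP; rewrite eqn_leq !ij.
Qed.

Lemma side_lower_bound (R : realType) N m (a : R) : (5 <= N)%N ->
  (m ^ 2 <= N)%N -> (N < m.+1 ^ 2)%N -> a \in @packing_sides R N ->
  N%:R - m%:R <= a ^+ 2 - a.
Proof.
move=> N5 mN Nm; rewrite inE => -[a0 [w [u pk]]].
have NR : 5 <= N%:R :> R by rewrite (ler_nat _ 5).
have a2 : 2 <= a.
  (* A side below 2 would fit into side 2, where [n = 2] gives [N <= 4]. *)
  rewrite leNgt; apply/negP => a2.
  by have := packs_le (n := 2) pk (ltW a2) (lexx 2) ltac:(lra); lra.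
have /andP[n1 n2] := truncn_itv (ltW a0).
have := packs_le pk (lexx a) a2 _; rewrite -natr1 in n2 => /(_ _ n2).
set n := Num.truncn a in n1 n2 * => HN.
have mR : m%:R ^+ 2 <= N%:R :> R by rewrite -natrX ler_nat.
have NmR : N%:R <= m%:R ^+ 2 + 2 * m%:R :> R.
  have : N.+1%:R <= m.+1%:R ^+ 2 :> R by rewrite -natrX ler_nat.
  by rewrite -!natr1; lra.
have m0 : 0 <= m%:R :> R by [].
have ma : m%:R <= a by rewrite -ler_sqr ?nnegrE; lra.
have mn : (m <= n)%N by rewrite -ltnS -(ltr_nat R) -natr1; lra.
(* As [n <= a], the mass bound gives [m ^ 2 <= N <= a ^+ 2], so [m <= n]. Equality is the claim;
   otherwise [a >= m + 1], and [a ^+ 2 - a >= m * (m + 1) >= N - m]. *)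
case: (leqP n m) => nm.
  by have -> : m = n by [apply/eqP; rewrite eqn_leq mn]; lra.
have ma' : m%:R + 1 <= a by apply: le_trans n1; rewrite natr1 ler_nat.
nra.
Qed.

Theorem corollary6p2 (R : realType) (N : nat)
    (hN : (8 <= N)%N) (hsq : ~ exists k : nat, N = (k ^ 2)%N) :
  s R N >= 1 / 2 +
    Num.sqrt (N%:R - (Num.floor (Num.sqrt (N%:R : R)))%:~R + 1 / 4) /\
  1 / 2 + Num.sqrt (N%:R - (Num.floor (Num.sqrt (N%:R : R)))%:~R + 1 / 4)
    > Num.sqrt (N%:R : R).
Proof.
set q := Num.sqrt (N%:R : R).
have q0 : 0 <= q by exact: sqrtr_ge0.
have q2 : q ^+ 2 = N%:R by rewrite sqr_sqrtr.
have [m mE] : exists m : nat, Num.floor q = m%:Z.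
  by exists `|Num.floor q|%N; rewrite gez0_abs// floor_ge0.
have /andP[] := floor_itv q; rewrite mE => mq qm.
rewrite -pmulrn in mq *.
rewrite intrD -pmulrn in qm.
have m0 : 0 <= m%:R :> R by [].
have mN : (m ^ 2 <= N)%N by rewrite -(ler_nat R) natrX -q2 ler_sqr ?nnegrE.
have Nm : (N < m.+1 ^ 2)%N.
  by rewrite -(ltr_nat R) natrX -q2 ltr_sqr ?nnegrE// -natr1.
have mq' : m%:R < q.
  rewrite lt_def mq andbT; apply/eqP => e; apply: hsq; exists m.
  by apply/eqP; rewrite -(eqr_nat R) natrX -q2 e.
have NmR : m%:R <= N%:R :> R.
  rewrite ler_nat; apply: leq_trans mN; case: (m) => // k.
  by rewrite expnS expn1 leq_pmulr.
have N8 : 8 <= N%:R :> R by rewrite (ler_nat _ 8).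
have q1 : 1 <= q by nra.
split; last first.
  (* Squaring [q - 1 / 2] reduces the strict inequality to [m%:R < q], which holds because [N] is
     not a square. *)
  rewrite -ltrBlDl -ltr_sqr ?nnegrE ?sqrtr_ge0//; last lra.
  by rewrite sqr_sqrtr -?q2; nra.
apply: lb_le_inf; first by apply: packing_sides_neq0; exact: leq_trans hN.
move=> a Sa; have := side_lower_bound (leq_trans _ hN) mN Nm (mem_set Sa).
move=> /(_ isT) H; have a0 : 0 < a by case: Sa.
have a1 : 1 <= a by rewrite leNgt; apply/negP => a1; nra.
(* Completing the square turns [N%:R - m%:R <= a ^+ 2 - a] into a bound on [(a - 1 / 2) ^+ 2]. *)
rewrite -lerBrDl -ler_sqr ?nnegrE ?sqrtr_ge0//; last lra.
by rewrite sqr_sqrtr; lra.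
Qed.
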